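(* Let $M$ be a complex manifold and $\mathfrak g$ a Lie algebra of holomorphic vector fields on $M$. (i) If $\mathfrak M_{\mathfrak g}(M)=0$ and $T_{\mathfrak g}(M)=0$, then $\Phi_1\colon\mathrm{Pic}_{\mathfrak g}(M)\to\mathrm{Pic}(M)$ is injective. (ii) If $\mathrm{Pic}(M)=0$ and $T_{\mathfrak g}(M)=0$, then $\Phi_2\colon\mathrm{Pic}_{\mathfrak g}(M)\to\mathfrak M_{\mathfrak g}(M)$ is injective.
   Context: $\mathcal O$ is the sheaf of holomorphic functions on $M$, $\mathcal O^\times$ the multiplicative sheaf of nonvanishing ones. $\mathfrak g$ may be infinite-dimensional. For an open cover $\mathcal U=\{U_\alpha\}$ of $M$ let $Z^1(\mathcal U)$ be the group of pairs $(g,\lambda)$, $g=\{g_{\alpha\beta}\in\mathcal O^\times(U_\alpha\cap U_\beta)\}$, $\lambda=\{\lambda_\alpha\in\mathrm{Hom}(\mathfrak g,\mathcal O(U_\alpha))\}$, such that $g_{\alpha\beta}g_{\beta\gamma}=g_{\alpha\gamma}$ on triple intersections, $X(\lambda_\alpha(Y))-Y(\lambda_\alpha(X))=\lambda_\alpha([X,Y])$ for all $X,Y\in\mathfrak g$, and $\lambda_\alpha(X)-\lambda_\beta(X)=X(g_{\alpha\beta})/g_{\alpha\beta}$ on $U_\alpha\cap U_\beta$ for all $X\in\mathfrak g$. Let $B^1(\mathcal U)$ be the subgroup of pairs with $g_{\alpha\beta}=\mu_\alpha/\mu_\beta$, $\lambda_\alpha(X)=X(\mu_\alpha)/\mu_\alpha$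 for some $\mu_\alpha\in\mathcal O^\times(U_\alpha)$. The $\mathfrak g$-equivariant Picard group is $\mathrm{Pic}_{\mathfrak g}(M)=\varinjlim_{\mathcal U}Z^1(\mathcal U)/B^1(\mathcal U)$ (direct limit over refinements). For $U\subset M$ open let $\tilde{\mathrm H}^1(\mathfrak g,\mathcal O(U))$ be the group of $\lambda\in\mathrm{Hom}(\mathfrak g,\mathcal O(U))$ with $X(\lambda(Y))-Y(\lambda(X))=\lambda([X,Y])$, modulo those of the form $\lambda(X)=X(\mu)/\mu$, $\mu\in\mathcal O^\times(U)$. The group of multipliers is $\mathfrak M_{\mathfrak g}(M)=\varinjlim_{\mathcal U}\mathfrak M_{\mathfrak g}(\mathcal U)$, where $\mathfrak M_{\mathfrak g}(\mathcal U)$ consists of $([\lambda_\alpha])\in\prod_\alpha\tilde{\mathrm H}^1(\mathfrak g,\mathcal O(U_\alpha))$ whose restrictions to $U_\alpha\cap U_\beta$ agree in $\tilde{\mathrm H}^1(\mathfrak g,\mathcal O(U_\alpha\cap U_\beta))$ for all $\alpha,\beta$. $\mathrm{Pic}(M)=\check{\mathrm H}^1(M,\mathcal O^\times)$. The homomorphisms $\Phi_1,\Phi_2$ are $\Phi_1([(g,\lambda)])=[g]$ and $\Phi_2([(g,\lambda)])=[\lambda]$. $T_{\mathfrak g}(M):=\ker(\Phi_1\times\Phi_2)\subset\mathrm{Pic}_{\mathfrak g}(M)$, where $\Phi_1\times\Phi_2\colon\mathrm{Pic}_{\mathfrak g}(M)\to\mathrm{Pic}(M)\times\mathfrak M_{\mathfrak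 g}(M)$. *)

(* Defs.v *)
From HB Require Import structures.
From mathcomp Require Import all_boot all_order all_algebra.
From mathcomp Require Import complex.
From mathcomp Require Import all_classical all_reals all_analysis.

Set Implicit Arguments.
Unset Strict Implicit.
Unset Printing Implicit Defensive.

Import Order.TTheory GRing.Theory Num.Theory.
Import numFieldNormedType.Exports.

Local Open Scope classical_set_scope.
Local Open Scope quotient_scope.
Local Open Scope ring_scope.

(* Quotient of a type by a relation for which it is an abelian group.         *)

Record setoid_group := SetoidGroup {
  sg_car : Type;
  sg_eq : sg_car -> sg_car -> Prop;
  sg_zero : sg_car;
  sg_opp : sg_car -> sg_car;
  sg_add : sg_car -> sg_car -> sg_car;
  sg_refl : forall a, sg_eq a a;
  sg_sym : forall a b, sg_eq a b -> sg_eq b a;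
  sg_trans : forall b a c, sg_eq a b -> sg_eq b c -> sg_eq a c;
  sg_oppE : forall a b, sg_eq a b -> sg_eq (sg_opp a) (sg_opp b);
  sg_addE : forall a a' b b',
    sg_eq a a' -> sg_eq b b' -> sg_eq (sg_add a b) (sg_add a' b');
  sg_addA : forall a b c, sg_eq (sg_add a (sg_add b c)) (sg_add (sg_add a b) c);
  sg_addC : forall a b, sg_eq (sg_add a b) (sg_add b a);
  sg_add0 : forall a, sg_eq (sg_add sg_zero a) a;
  sg_addN : forall a, sg_eq (sg_add (sg_opp a) a) sg_zero }.

Section SetoidQuotient.
Variable S : setoid_group.

Definition sg_rel : rel {classic sg_car S} := fun a b => `[< sg_eq a b >].

Lemma sg_rel_refl : reflexive sg_rel.
Proof. by move=> a; apply/asboolP/sg_refl. Qed.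

Lemma sg_rel_sym : symmetric sg_rel.
Proof. by move=> a b; apply/asboolP/asboolP => /sg_sym. Qed.

Lemma sg_rel_trans : transitive sg_rel.
Proof.
by move=> b a c /asboolP ab /asboolP bc; apply/asboolP/(sg_trans ab bc).
Qed.

Canonical sg_equiv := EquivRel sg_rel sg_rel_refl sg_rel_sym sg_rel_trans.

Definition sg_quot : Type := {eq_quot sg_equiv}.

HB.instance Definition _ := Choice.on sg_quot.

Definition sg_cls (a : sg_car S) : sg_quot :=
  \pi_({eq_quot sg_equiv}) (a : {classic sg_car S}).

Definition sg_repr (x : sg_quot) : sg_car S := repr (x : {eq_quot sg_equiv}).

Lemma sg_reprK x : sg_cls (sg_repr x) = x.
Proof. exact: reprK. Qed.

Lemma sg_clsP a b : sg_cls a = sg_cls b <-> sg_eq a b.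
Proof.
split=> [/eqquotP/asboolP//|ab]; apply/eqquotP/asboolP/ab.
Qed.

Lemma sg_repr_cls a : sg_eq (sg_repr (sg_cls a)) a.
Proof. by apply/sg_clsP; rewrite sg_reprK. Qed.

Lemma sg_clsW (P : sg_quot -> Prop) : (forall a, P (sg_cls a)) -> forall x, P x.
Proof. by move=> H x; rewrite -(sg_reprK x). Qed.

Definition sgq_zero := sg_cls (sg_zero S).
Definition sgq_opp x := sg_cls (sg_opp (sg_repr x)).
Definition sgq_add x y := sg_cls (sg_add (sg_repr x) (sg_repr y)).

Lemma sgq_oppE a : sgq_opp (sg_cls a) = sg_cls (sg_opp a).
Proof. exact/sg_clsP/sg_oppE/sg_repr_cls. Qed.

Lemma sgq_addE a b : sgq_add (sg_cls a) (sg_cls b) = sg_cls (sg_add a b).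
Proof. by apply/sg_clsP/sg_addE; exact: sg_repr_cls. Qed.

Lemma sgq_addA : associative sgq_add.
Proof.
elim/sg_clsW=> a; elim/sg_clsW=> b; elim/sg_clsW=> c.
by rewrite !sgq_addE; apply/sg_clsP/sg_addA.
Qed.

Lemma sgq_addC : commutative sgq_add.
Proof.
elim/sg_clsW=> a; elim/sg_clsW=> b.
by rewrite !sgq_addE; apply/sg_clsP/sg_addC.
Qed.

Lemma sgq_add0 : left_id sgq_zero sgq_add.
Proof. by elim/sg_clsW=> a; rewrite sgq_addE; apply/sg_clsP/sg_add0. Qed.

Lemma sgq_addN : left_inverse sgq_zero sgq_opp sgq_add.
Proof.
by elim/sg_clsW=> a; rewrite sgq_oppE sgq_addE; apply/sg_clsP/sg_addN.
Qed.

HB.instance Definition _ :=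
  GRing.isZmodule.Build sg_quot sgq_addA sgq_addC sgq_add0 sgq_addN.

Lemma sg_cls0 : sg_cls (sg_zero S) = 0. Proof. by []. Qed.
Lemma sg_clsD a b : sg_cls (sg_add a b) = sg_cls a + sg_cls b.
Proof. by rewrite -sgq_addE. Qed.
Lemma sg_clsN a : sg_cls (sg_opp a) = - sg_cls a.
Proof. by rewrite -sgq_oppE. Qed.

Section Lift.
Variables (G : zmodType) (f : sg_car S -> G).
Hypothesis fE : forall a b, sg_eq a b -> f a = f b.
Hypothesis fD : forall a b, f (sg_add a b) = f a + f b.

Definition sg_lift of (forall a b, sg_eq a b -> f a = f b)
  & (forall a b, f (sg_add a b) = f a + f b) := fun x => f (sg_repr x).

Local Notation lf := (sg_lift fE fD).

Lemma sg_liftE a : lf (sg_cls a) = f a.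
Proof. exact/fE/sg_repr_cls. Qed.

Lemma sg_lift_additive : zmod_morphism lf.
Proof.
have fD' x y : lf (x + y) = lf x + lf y.
  elim/sg_clsW: x => a; elim/sg_clsW: y => b.
  by rewrite -sg_clsD !sg_liftE fD.
by move=> x y; apply/eqP; rewrite eq_sym subr_eq -fD' subrK.
Qed.

HB.instance Definition _ := GRing.isZmodMorphism.Build sg_quot G lf
  sg_lift_additive.
End Lift.

End SetoidQuotient.

(* Z / B, for subgroups B of Z given as predicates on a type [sq_amb] of      *)
(* representatives.  Only the quotient has to be a group: [sq_add a           *)
(* (sq_opp a)] need not be [sq_zero], it only has to lie in B (representatives*)
(* will be functions carrying irrelevant values off their open set).          *)

Record subquotient := Subquotient {
  sq_amb : Type;
  sq_zero : sq_amb;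
  sq_opp : sq_amb -> sq_amb;
  sq_add : sq_amb -> sq_amb -> sq_amb;
  sq_Z : sq_amb -> Prop;
  sq_B : sq_amb -> Prop;
  sq_addA : associative sq_add;
  sq_addC : commutative sq_add;
  sq_add0 : left_id sq_zero sq_add;
  sq_opp0 : sq_opp sq_zero = sq_zero;
  sq_oppK : involutive sq_opp;
  sq_oppD : {morph sq_opp : a b / sq_add a b};
  sq_Z0 : sq_Z sq_zero;
  sq_ZN : forall a, sq_Z a -> sq_Z (sq_opp a);
  sq_ZD : forall a b, sq_Z a -> sq_Z b -> sq_Z (sq_add a b);
  sq_BN : forall a, sq_B a -> sq_B (sq_opp a);
  sq_BD : forall a b, sq_B a -> sq_B b -> sq_B (sq_add a b);
  sq_Bsub : forall a, sq_Z a -> sq_B (sq_add a (sq_opp a));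
  sq_Bcancel : forall a b, sq_Z b ->
    sq_B (sq_add a (sq_add b (sq_opp b))) -> sq_B a }.

Section SubquotientGroup.
Variable A : subquotient.

Local Notation T := {a : sq_amb A | sq_Z a}.
Local Notation "a [+] b" := (sq_add a b) (at level 50, left associativity).
Local Notation "[-] a" := (sq_opp a) (at level 35, right associativity).

Definition sqq_eq (a b : T) : Prop := sq_B (sval a [+] [-] sval b).
Definition sqq_zero : T := exist _ _ (sq_Z0 A).
Definition sqq_opp (a : T) : T := exist _ _ (sq_ZN (proj2_sig a)).
Definition sqq_add (a b : T) : T := exist _ _ (sq_ZD (proj2_sig a) (proj2_sig b)).

Lemma sq_addACA : interchange (@sq_add A) (@sq_add A).
Proof.
move=> a b c d.
by rewrite -!sq_addA; congr sq_add; rewrite !sq_addA (sq_addC b).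
Qed.

Lemma sqq_refl a : sqq_eq a a.
Proof. exact/sq_Bsub/svalP. Qed.

Lemma sqq_sym a b : sqq_eq a b -> sqq_eq b a.
Proof. by move=> /sq_BN; rewrite sq_oppD sq_oppK sq_addC. Qed.

Lemma sqq_trans b a c : sqq_eq a b -> sqq_eq b c -> sqq_eq a c.
Proof.
move=> ab bc; apply: (sq_Bcancel (svalP b)).
by rewrite (sq_addC (sval b)) sq_addACA (sq_addC _ (sval b)); exact: sq_BD.
Qed.

Lemma sqq_oppE a b : sqq_eq a b -> sqq_eq (sqq_opp a) (sqq_opp b).
Proof. by move=> /sq_BN; rewrite sq_oppD. Qed.

Lemma sqq_addE a a' b b' :
  sqq_eq a a' -> sqq_eq b b' -> sqq_eq (sqq_add a b) (sqq_add a' b').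
Proof.
by move=> aa' bb'; rewrite /sqq_eq /= sq_oppD sq_addACA; exact: sq_BD.
Qed.

Lemma sqq_eqval (a b : T) : sval a = sval b -> sqq_eq a b.
Proof. by rewrite /sqq_eq => ->; exact/sq_Bsub/svalP. Qed.

Lemma sqq_addA a b c :
  sqq_eq (sqq_add a (sqq_add b c)) (sqq_add (sqq_add a b) c).
Proof. exact/sqq_eqval/sq_addA. Qed.

Lemma sqq_addC a b : sqq_eq (sqq_add a b) (sqq_add b a).
Proof. exact/sqq_eqval/sq_addC. Qed.

Lemma sqq_add0 a : sqq_eq (sqq_add sqq_zero a) a.
Proof. exact/sqq_eqval/sq_add0. Qed.

Lemma sqq_addN a : sqq_eq (sqq_add (sqq_opp a) a) sqq_zero.
Proof.
rewrite /sqq_eq /= sq_opp0 sq_addC sq_add0 sq_addC.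
exact/sq_Bsub/svalP.
Qed.

Definition sq_setoid : setoid_group := SetoidGroup sqq_refl sqq_sym sqq_trans
  sqq_oppE sqq_addE sqq_addA sqq_addC sqq_add0 sqq_addN.

Definition sq_quot : zmodType := sg_quot sq_setoid.

Definition sq_cls (a : sq_amb A) (Za : sq_Z a) : sq_quot :=
  @sg_cls sq_setoid (exist _ a Za).

Lemma sq_clsP a b (Za : sq_Z a) (Zb : sq_Z b) :
  sq_cls Za = sq_cls Zb <-> sq_B (a [+] [-] b).
Proof. exact: sg_clsP. Qed.

Lemma sq_clsW (P : sq_quot -> Prop) :
  (forall a (Za : sq_Z a), P (sq_cls Za)) -> forall x, P x.
Proof. by move=> H; apply: sg_clsW => -[a Za]; exact: H. Qed.

Lemma sq_clsD a b (Za : sq_Z a) (Zb : sq_Z b) :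
  sq_cls (sq_ZD Za Zb) = sq_cls Za + sq_cls Zb.
Proof. exact: (@sg_clsD sq_setoid (exist _ a Za) (exist _ b Zb)). Qed.

Lemma sq_cls_irr a b (Za : sq_Z a) (Zb : sq_Z b) : a = b ->
  sq_cls Za = sq_cls Zb.
Proof. by move=> ab; subst b; congr sq_cls; exact: Prop_irrelevance. Qed.

End SubquotientGroup.

Section SubquotientMap.
Variables A B : subquotient.

(* Additive on representatives, Z to Z and B to B. *)
Record sq_morphism := SqMorphism {
  sqm_fun :> sq_amb A -> sq_amb B;
  sqm_add : {morph sqm_fun : a b / sq_add a b};
  sqm_opp : {morph sqm_fun : a / sq_opp a};
  sqm_Z : forall a, sq_Z a -> sq_Z (sqm_fun a);
  sqm_B : forall a, sq_B a -> sq_B (sqm_fun a) }.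

Variable f : sq_morphism.

Definition sqm_pre (a : sg_car (sq_setoid A)) : sq_quot B :=
  sq_cls (sqm_Z f (proj2_sig a)).

Lemma sqm_preE a b : @sg_eq (sq_setoid A) a b -> sqm_pre a = sqm_pre b.
Proof. by move=> ab; apply/sq_clsP; rewrite -sqm_opp -sqm_add; apply: sqm_B. Qed.

Lemma sqm_preD a b :
  sqm_pre (@sg_add (sq_setoid A) a b) = sqm_pre a + sqm_pre b.
Proof.
by rewrite /sqm_pre -sq_clsD; apply: sq_cls_irr; rewrite /= sqm_add.
Qed.

Definition sq_map : {additive sq_quot A -> sq_quot B} := sg_lift sqm_preE sqm_preD.

Lemma sq_mapE a (Za : sq_Z a) : sq_map (sq_cls Za) = sq_cls (sqm_Z f Za).
Proof. exact: (@sg_liftE (sq_setoid A)). Qed.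

End SubquotientMap.

(* Direct limit of abelian groups over a directed preorder.                   *)

Record directed := Directed {
  dir_ix :> Type;
  dir_le : dir_ix -> dir_ix -> Prop;
  dir_pt : dir_ix;
  dir_join : dir_ix -> dir_ix -> dir_ix;
  dir_refl : forall u, dir_le u u;
  dir_trans : forall v u w, dir_le u v -> dir_le v w -> dir_le u w;
  dir_joinl : forall u v, dir_le u (dir_join u v);
  dir_joinr : forall u v, dir_le v (dir_join u v) }.

Record directed_system (I : directed) := DirectedSystem {
  ds_grp :> I -> zmodType;
  ds_map : forall u v, dir_le u v -> {additive ds_grp u -> ds_grp v};
  ds_id : forall u (p : dir_le u u) a, ds_map p a = a;
  ds_comp : forall u v w (p : dir_le u v) (q : dir_le v w) (r : dir_le u w) a,
    ds_map q (ds_map p a) = ds_map r a }.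

Section DirectLimit.
Variables (I : directed) (D : directed_system I).

Local Notation T := {u : I & D u}.
Implicit Types a b c : T.

Definition dl_eq (a b : T) : Prop :=
  exists w (p : dir_le (tag a) w) (q : dir_le (tag b) w),
    ds_map D p (tagged a) = ds_map D q (tagged b).

Definition dl_zero : T := existT _ (dir_pt I) (0 : D (dir_pt I)).
Definition dl_opp (a : T) : T := existT _ (tag a) (- tagged a : D (tag a)).
Definition dl_add (a b : T) : T :=
  existT _ (dir_join (tag a) (tag b))
    (ds_map D (dir_joinl _ _) (tagged a) + ds_map D (dir_joinr _ _) (tagged b)
      : D (dir_join (tag a) (tag b))).

Lemma dl_refl a : dl_eq a a.
Proof. by exists (tag a), (dir_refl _), (dir_refl _). Qed.

Lemma dl_sym a b : dl_eq a b -> dl_eq b a.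
Proof. by move=> [w [p [q e]]]; exists w, q, p. Qed.

Lemma dl_eq_up a b w (p : dir_le (tag a) w) (q : dir_le (tag b) w) w'
    (p' : dir_le (tag a) w') (q' : dir_le (tag b) w') (r : dir_le w w') :
  ds_map D p (tagged a) = ds_map D q (tagged b) ->
  ds_map D p' (tagged a) = ds_map D q' (tagged b).
Proof.
by move=> e; rewrite -(ds_comp p r p') e (ds_comp q r q').
Qed.

Lemma dl_trans b a c : dl_eq a b -> dl_eq b c -> dl_eq a c.
Proof.
move=> [w [p [q e]]] [w' [p' [q' e']]].
have r := dir_joinl w w'; have r' := dir_joinr w w'.
exists (dir_join w w'), (dir_trans p r), (dir_trans q' r').
rewrite (dl_eq_up (dir_trans p r) (dir_trans q r) r e).
by rewrite (dl_eq_up (dir_trans q r) (dir_trans q' r') r' e').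
Qed.

Lemma dl_oppE a b : dl_eq a b -> dl_eq (dl_opp a) (dl_opp b).
Proof. by move=> [w [p [q e]]]; exists w, p, q; rewrite /= !raddfN e. Qed.

Lemma dl_addE a a' b b' :
  dl_eq a a' -> dl_eq b b' -> dl_eq (dl_add a b) (dl_add a' b').
Proof.
move=> [w [p [q e]]] [w' [p' [q' e']]].
set s := dir_join (dir_join (tag a) (tag b)) (dir_join (tag a') (tag b')).
have l : dir_le (tag (dl_add a b)) s by exact: dir_joinl.
have l' : dir_le (tag (dl_add a' b')) s by exact: dir_joinr.
pose t := dir_join s (dir_join w w').
have st : dir_le s t := dir_joinl _ _.
have wt : dir_le w t := dir_trans (dir_joinl _ _) (dir_joinr _ _).
have w't : dir_le w' t := dir_trans (dir_joinr _ _) (dir_joinr _ _).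
exists t, (dir_trans l st), (dir_trans l' st).
rewrite /= !raddfD.
rewrite !(ds_comp _ _ (dir_trans p wt)) !(ds_comp _ _ (dir_trans p' w't)).
rewrite !(ds_comp _ _ (dir_trans q wt)) !(ds_comp _ _ (dir_trans q' w't)).
by rewrite (dl_eq_up (dir_trans p wt) (dir_trans q wt) wt e)
  (dl_eq_up (dir_trans p' w't) (dir_trans q' w't) w't e').
Qed.

Lemma dl_addA a b c : dl_eq (dl_add a (dl_add b c)) (dl_add (dl_add a b) c).
Proof.
pose t := dir_join (tag (dl_add a (dl_add b c))) (tag (dl_add (dl_add a b) c)).
have l : dir_le (tag (dl_add a (dl_add b c))) t := dir_joinl _ _.
have l' : dir_le (tag (dl_add (dl_add a b) c)) t := dir_joinr _ _.
have at_ : dir_le (tag a) t := dir_trans (dir_joinl _ _) l.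
have bt : dir_le (tag b) t :=
  dir_trans (dir_trans (dir_joinl _ _) (dir_joinr _ _)) l.
have ct : dir_le (tag c) t := dir_trans (dir_joinr _ _) l'.
exists t, l, l'; rewrite /= !raddfD /=.
have E u v w (p : dir_le u v) (q : dir_le v w) (r : dir_le w t)
    (s : dir_le u t) x : ds_map D r (ds_map D q (ds_map D p x)) = ds_map D s x.
  by rewrite (ds_comp p q (dir_trans p q)) (ds_comp _ _ s).
rewrite !(E _ _ _ _ _ _ at_) !(E _ _ _ _ _ _ bt) !(E _ _ _ _ _ _ ct).
by rewrite !(ds_comp _ _ at_) !(ds_comp _ _ ct) addrA.
Qed.

Lemma dl_addC a b : dl_eq (dl_add a b) (dl_add b a).
Proof.
pose t := dir_join (tag (dl_add a b)) (tag (dl_add b a)).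
have l : dir_le (tag (dl_add a b)) t := dir_joinl _ _.
have l' : dir_le (tag (dl_add b a)) t := dir_joinr _ _.
have at_ : dir_le (tag a) t := dir_trans (dir_joinl _ _) l.
have bt : dir_le (tag b) t := dir_trans (dir_joinr _ _) l.
exists t, l, l'; rewrite /= !raddfD /=.
by rewrite !(ds_comp _ _ at_) !(ds_comp _ _ bt) addrC.
Qed.

Lemma dl_add0 a : dl_eq (dl_add dl_zero a) a.
Proof.
exists (tag (dl_add dl_zero a)), (dir_refl _), (dir_joinr _ _).
by rewrite /= ds_id raddf0 add0r.
Qed.

Lemma dl_addN a : dl_eq (dl_add (dl_opp a) a) dl_zero.
Proof.
pose t := dir_join (tag (dl_add (dl_opp a) a)) (dir_pt I).
have l : dir_le (tag (dl_add (dl_opp a) a)) t := dir_joinl _ _.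
have at_ : dir_le (tag a) t := dir_trans (dir_joinl _ _) l.
exists t, l, (dir_joinr _ _).
by rewrite /= !raddfD /= !(ds_comp _ _ at_) !raddfN addNr raddf0.
Qed.

Definition dl_setoid : setoid_group := SetoidGroup dl_refl dl_sym dl_trans
  dl_oppE dl_addE dl_addA dl_addC dl_add0 dl_addN.

Definition dirlim : zmodType := sg_quot dl_setoid.

Definition dl_cls u (a : D u) : dirlim := @sg_cls dl_setoid (existT _ u a).

Lemma dl_clsP u v (a : D u) (b : D v) :
  dl_cls a = dl_cls b <-> exists w (p : dir_le u w) (q : dir_le v w),
    ds_map D p a = ds_map D q b.
Proof. exact: sg_clsP. Qed.

Lemma dl_clsW (P : dirlim -> Prop) :
  (forall u (a : D u), P (dl_cls a)) -> forall x, P x.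
Proof. by move=> H; apply: sg_clsW => -[u a]; exact: H. Qed.

End DirectLimit.

Section DirectLimitMap.
Variables (I : directed) (D E : directed_system I).

Record ds_morphism := DsMorphism {
  dsm_fun :> forall u, {additive D u -> E u};
  dsm_comm : forall u v (p : dir_le u v) a,
    ds_map E p (dsm_fun u a) = dsm_fun v (ds_map D p a) }.

Variable f : ds_morphism.

Definition dlm_pre (a : sg_car (dl_setoid D)) : dirlim E :=
  dl_cls (f (tag a) (tagged a)).

Lemma dlm_preE a b : @sg_eq (dl_setoid D) a b -> dlm_pre a = dlm_pre b.
Proof.
move=> [w [p [q e]]]; apply/dl_clsP; exists w, p, q.
by rewrite !dsm_comm e.
Qed.

Lemma dlm_preD a b :
  dlm_pre (@sg_add (dl_setoid D) a b) = dlm_pre a + dlm_pre b.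
Proof.
rewrite /dlm_pre /dl_cls -(@sg_clsD (dl_setoid E)) /=.
by congr sg_cls; rewrite /dl_add /= raddfD /= !dsm_comm.
Qed.

Definition dl_map : {additive dirlim D -> dirlim E} := sg_lift dlm_preE dlm_preD.

Lemma dl_mapE u (a : D u) : dl_map (dl_cls a) = dl_cls (f u a).
Proof. exact: (@sg_liftE (dl_setoid D)). Qed.

End DirectLimitMap.

(* The topology of the norm is found by unification on numFieldTypes only. *)
Definition Cx (R : realType) : numFieldType := R[i]%C.

Record complex_manifold (R : realType) (n : nat) := ComplexManifold {
  mfd_space :> topologicalType;
  mfd_hausdorff : hausdorff_space mfd_space;
  mfd_second_countable : @second_countable mfd_space;
  chart : Type;
  dom : chart -> set mfd_space;
  coord : chart -> mfd_space -> 'rV[Cx R]_n;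
  coordV : chart -> 'rV[Cx R]_n -> mfd_space;
  chart_at : mfd_space -> chart;
  dom_open : forall i, open (dom i);
  cod_open : forall i, open (coord i @` dom i);
  coordK : forall i x, dom i x -> coordV i (coord i x) = x;
  coord_cont : forall i x, dom i x -> {for x, continuous (coord i)};
  coordV_cont : forall i x, dom i x -> {for coord i x, continuous (coordV i)};
  chart_atP : forall x, dom (chart_at x) x;
  transition_holomorphic : forall i j x, dom i x -> dom j x ->
    differentiable (coord j \o coordV i) (coord i x) }.

Section Manifold.
Variables (R : realType) (n : nat) (M : complex_manifold R n).

Local Notation C := (Cx R).

(* Sections over U are represented by functions on M, of which only the       *)
(* values on U matter.                                                        *)

Definition holomorphic (U : set M) (f : M -> C) : Prop :=
  forall i x, U x -> dom i x -> differentiable (f \o coordV i) (coord i x).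

Definition nonvanishing_holomorphic (U : set M) (f : M -> C) : Prop :=
  holomorphic U f /\ forall x, U x -> f x != 0.

(* A vector field is given by its components in every chart, which are        *)
(* functions of the coordinates, extended by 0.                               *)

Definition vfield : lmodType C := chart M -> 'rV[C]_n -> 'rV[C]_n.

Definition holomorphic_vfield (X : vfield) : Prop :=
  [/\ forall i z, ~ (coord i @` dom i) z -> X i z = 0,
      forall i x, dom i x -> differentiable (X i) (coord i x) &
      forall i j x, dom i x -> dom j x ->
        X j (coord j x) = 'd (coord j \o coordV i) (coord i x) (X i (coord i x))].

(* X(f); any chart around x gives the same value, see vf_app_chart.           *)
Definition vf_app (X : vfield) (f : M -> C) (x : M) : C :=
  let i := chart_at x in 'd (f \o coordV i) (coord i x) (X i (coord i x)).

Definition vf_bracket (X Y : vfield) : vfield :=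
  fun i z => 'd (Y i) z (X i z) - 'd (X i) z (Y i z).

Lemma vf_app_chart (X : vfield) (f : M -> C) (U : set M) j x :
  holomorphic_vfield X -> open U -> holomorphic U f -> U x -> dom j x ->
  vf_app X f x = 'd (f \o coordV j) (coord j x) (X j (coord j x)).
Proof.
move=> [_ _ HX] oU Hf Ux jx; rewrite /vf_app; set i := chart_at x.
have ix : dom i x := chart_atP x.
rewrite (HX i j x ix jx).
have dj := Hf j x Ux jx; have dij := transition_holomorphic ix jx.
have e : (coord j \o coordV i) (coord i x) = coord j x.
  by rewrite /comp coordK.
have dj' : differentiable (f \o coordV j) ((coord j \o coordV i) (coord i x)).
  by rewrite e.
have H := congr1 (fun k : 'rV[C]_n -> C => k (X i (coord i x)))
    (diff_comp dij dj').
rewrite /= (coordK ix) in H.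
clearbody i.
have N : 'D_(X i (coord i x)) (f \o coordV i) (coord i x) =
    'D_(X i (coord i x)) ((f \o coordV j) \o (coord j \o coordV i)) (coord i x).
  apply: near_eq_derive.
  have cV := coordV_cont ix.
  have oW : nbhs x (U `&` dom j).
    by apply: open_nbhs_nbhs; split; [apply: openI => //; exact: dom_open|].
  have : nbhs (coord i x) (coordV i @^-1` (U `&` dom j)).
    by apply: cV; rewrite coordK.
  by apply: filterS => z [_ jz] /=; rewrite coordK.
have A := deriveE (X i (coord i x)) (Hf i x Ux ix).
have B := deriveE (X i (coord i x)) (differentiable_comp dij dj').
exact: (etrans (esym A) (etrans N (etrans B H))).
Qed.

Record vf_lie_algebra := VfLieAlgebra {
  vfl_mem :> vfield -> Prop;
  vfl_holomorphic : forall X, vfl_mem X -> holomorphic_vfield X;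
  vfl_0 : vfl_mem 0;
  vfl_lin : forall (c : C) X Y, vfl_mem X -> vfl_mem Y -> vfl_mem (c *: X + Y);
  vfl_bracket : forall X Y, vfl_mem X -> vfl_mem Y -> vfl_mem (vf_bracket X Y) }.

Section Functions.
Variables (U : set M).

Lemma holomorphic_cst c : holomorphic U (fun=> c).
Proof. by move=> i x _ _; exact: differentiable_cst. Qed.

Lemma holomorphicD f h : holomorphic U f -> holomorphic U h ->
  holomorphic U (fun x => f x + h x).
Proof. move=> Hf Hh i x Ux ix; exact: (differentiableD (Hf _ _ Ux ix) (Hh _ _ Ux ix)). Qed.

Lemma holomorphicN f : holomorphic U f -> holomorphic U (fun x => - f x).
Proof. by move=> Hf i x Ux ix; exact: (differentiableN (Hf _ _ Ux ix)). Qed.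

Lemma nvhol1 : nonvanishing_holomorphic U (fun=> 1).
Proof. by split=> [|x _]; [exact: holomorphic_cst|exact: oner_neq0]. Qed.

Lemma nvholM f h :
  nonvanishing_holomorphic U f -> nonvanishing_holomorphic U h ->
  nonvanishing_holomorphic U (fun x => f x * h x).
Proof.
move=> [Hf f0] [Hh h0]; split=> [i x Ux ix|x Ux]; last first.
  by rewrite mulf_neq0 ?f0 ?h0.
exact: (differentiableM (Hf _ _ Ux ix) (Hh _ _ Ux ix)).
Qed.

Lemma nvholV f : nonvanishing_holomorphic U f ->
  nonvanishing_holomorphic U (fun x => (f x)^-1).
Proof.
move=> [Hf f0]; split=> [i x Ux ix|x Ux]; last by rewrite invr_neq0 ?f0.
apply: (@differentiableV _ _ (f \o coordV i)); first exact: Hf.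
by rewrite /= coordK// f0.
Qed.

Lemma nvholS (V : set M) f : V `<=` U -> nonvanishing_holomorphic U f ->
  nonvanishing_holomorphic V f.
Proof. by move=> VU [Hf f0]; split=> [i x /VU|x /VU]; [exact: Hf|exact: f0]. Qed.

Variables (X : vfield) (x : M).
Hypothesis Ux : U x.

Lemma vf_app_cst c : vf_app X (fun=> c) x = 0.
Proof. by rewrite /vf_app (_ : _ \o _ = cst c)// diff_cst. Qed.

Lemma vf_appD f h : holomorphic U f -> holomorphic U h ->
  vf_app X (fun x => f x + h x) x = vf_app X f x + vf_app X h x.
Proof.
move=> Hf Hh; have ix := chart_atP x.
have := diffD (Hf _ _ Ux ix) (Hh _ _ Ux ix).
by move=> /(congr1 (fun k => k (X (chart_at x) (coord (chart_at x) x)))).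
Qed.

Lemma vf_appN f : holomorphic U f ->
  vf_app X (fun x => - f x) x = - vf_app X f x.
Proof.
move=> Hf; have ix := chart_atP x.
have := diffN (Hf _ _ Ux ix).
by move=> /(congr1 (fun k => k (X (chart_at x) (coord (chart_at x) x)))).
Qed.

Lemma vf_dlogM f h :
  nonvanishing_holomorphic U f -> nonvanishing_holomorphic U h ->
  vf_app X (fun x => f x * h x) x / (f x * h x) =
  vf_app X f x / f x + vf_app X h x / h x.
Proof.
move=> [Hf f0] [Hh h0]; have ix := chart_atP x.
have e := coordK ix.
have -> : vf_app X (fun x => f x * h x) x =
    f x * vf_app X h x + h x * vf_app X f x.
  have := congr1 (fun k : 'rV[C]_n -> C => k (X (chart_at x) (coord (chart_at x) x)))
    (diffM (Hf _ _ Ux ix) (Hh _ _ Ux ix)).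
  by rewrite /comp e.
have {}f0 := f0 _ Ux; have {}h0 := h0 _ Ux.
rewrite mulrDl addrC; congr (_ + _).
  by rewrite (mulrC (f x)) invfM mulrACA mulfV// mul1r.
by rewrite invfM mulrACA mulfV// mul1r.
Qed.

Lemma vf_dlogV f : nonvanishing_holomorphic U f ->
  vf_app X (fun x => (f x)^-1) x / (f x)^-1 = - (vf_app X f x / f x).
Proof.
move=> [Hf f0]; have ix := chart_atP x; have {}f0 := f0 _ Ux.
have e := coordK ix.
have f0' : (f \o coordV (chart_at x)) (coord (chart_at x) x) != 0.
  by rewrite /comp e.
have -> : vf_app X (fun x => (f x)^-1) x = - (f x) ^- 2 * vf_app X f x.
  have := congr1 (fun k : 'rV[C]_n -> C => k (X (chart_at x) (coord (chart_at x) x)))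
    (diffV (Hf _ _ Ux ix) f0').
  by rewrite /comp e.
rewrite invrK.
by rewrite !mulNr mulrAC expr2 invfM mulfVK// mulrC.
Qed.

End Functions.

Variable g : vf_lie_algebra.

(* lambda in Hom(g, O(U)) with X(lambda Y) - Y(lambda X) = lambda [X, Y]; the *)
(* values of lambda off g are irrelevant.                                     *)
Definition lie_cocycle (U : set M) (l : vfield -> M -> C) : Prop :=
  [/\ forall X, g X -> holomorphic U (l X),
      forall (c : C) X Y x, g X -> g Y -> U x ->
        l (c *: X + Y) x = c * l X x + l Y x &
      forall X Y x, g X -> g Y -> U x ->
        vf_app X (l Y) x - vf_app Y (l X) x = l (vf_bracket X Y) x].

Definition lie_dlog (U : set M) (mu : M -> C) (l : vfield -> M -> C) : Prop :=
  forall X x, g X -> U x -> l X x = vf_app X mu x / mu x.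

Definition lam := vfield -> M -> C.
Definition lam0 : lam := fun _ _ => 0.
Definition lamN (l : lam) : lam := fun X x => - l X x.
Definition lamD (l k : lam) : lam := fun X x => l X x + k X x.

Lemma lamA : associative lamD.
Proof. by move=> l k h; apply/funext => X; apply/funext => x; exact: addrA. Qed.
Lemma lamC : commutative lamD.
Proof. by move=> l k; apply/funext => X; apply/funext => x; exact: addrC. Qed.
Lemma lam0D : left_id lam0 lamD.
Proof. by move=> l; apply/funext => X; apply/funext => x; exact: add0r. Qed.
Lemma lamN0 : lamN lam0 = lam0.
Proof. by apply/funext => X; apply/funext => x; exact: oppr0. Qed.
Lemma lamNK : involutive lamN.
Proof. by move=> l; apply/funext => X; apply/funext => x; exact: opprK. Qed.
Lemma lamND : {morph lamN : l k / lamD l k}.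
Proof. by move=> l k; apply/funext => X; apply/funext => x; exact: opprD. Qed.

Section LieCocycles.
Variable U : set M.

Lemma lie_cocycle0 : lie_cocycle U lam0.
Proof.
split=> [X _|c X Y x _ _ _|X Y x _ _ Ux]; first exact: holomorphic_cst.
  by rewrite /lam0 mulr0 addr0.
by rewrite !vf_app_cst subr0.
Qed.

Lemma lie_cocycleN l : lie_cocycle U l -> lie_cocycle U (lamN l).
Proof.
move=> [lH lL lC]; split=> [X gX|c X Y x gX gY Ux|X Y x gX gY Ux].
- exact/holomorphicN/lH.
- by rewrite /lamN lL// opprD mulrN.
- rewrite (vf_appN _ Ux (lH _ gY)) (vf_appN _ Ux (lH _ gX)) /lamN -lC//.
  by rewrite opprB opprK addrC.
Qed.

Lemma lie_cocycleD l k : lie_cocycle U l -> lie_cocycle U k ->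
  lie_cocycle U (lamD l k).
Proof.
move=> [lH lL lC] [kH kL kC]; split=> [X gX|c X Y x gX gY Ux|X Y x gX gY Ux].
- by apply: holomorphicD; [exact: lH|exact: kH].
- by rewrite /lamD lL// kL// mulrDr addrACA.
- rewrite (vf_appD _ Ux (lH _ gY) (kH _ gY)) (vf_appD _ Ux (lH _ gX) (kH _ gX)).
  by rewrite /lamD -lC// -kC// opprD addrACA.
Qed.

Lemma lie_dlog1 : lie_dlog U (fun=> 1) lam0.
Proof. by move=> X x _ Ux; rewrite vf_app_cst mul0r. Qed.

Lemma lie_dlogN mu l : nonvanishing_holomorphic U mu -> lie_dlog U mu l ->
  lie_dlog U (fun x => (mu x)^-1) (lamN l).
Proof.
by move=> Hmu Hl X x gX Ux; rewrite (vf_dlogV _ Ux)// /lamN Hl.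
Qed.

Lemma lie_dlogD mu nu l k :
  nonvanishing_holomorphic U mu -> nonvanishing_holomorphic U nu ->
  lie_dlog U mu l -> lie_dlog U nu k ->
  lie_dlog U (fun x => mu x * nu x) (lamD l k).
Proof.
by move=> Hmu Hnu Hl Hk X x gX Ux; rewrite (vf_dlogM _ Ux)// /lamD Hl// Hk.
Qed.

Definition lie_coboundary (l : lam) : Prop :=
  exists2 mu, nonvanishing_holomorphic U mu & lie_dlog U mu l.

Lemma lie_coboundaryN l : lie_coboundary l -> lie_coboundary (lamN l).
Proof.
move=> [mu Hmu Hl]; exists (fun x => (mu x)^-1); first exact: nvholV.
exact: lie_dlogN.
Qed.

Lemma lie_coboundaryD l k : lie_coboundary l -> lie_coboundary k ->
  lie_coboundary (lamD l k).
Proof.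
move=> [mu Hmu Hl] [nu Hnu Hk]; exists (fun x => mu x * nu x).
  exact: nvholM.
exact: lie_dlogD.
Qed.

Lemma lamDN l : lamD l (lamN l) = lam0.
Proof. by apply/funext => X; apply/funext => x; exact: subrr. Qed.

Lemma lie_coboundary_sub l : lie_cocycle U l -> lie_coboundary (lamD l (lamN l)).
Proof.
by move=> _; rewrite lamDN; exists (fun=> 1); [exact: nvhol1|exact: lie_dlog1].
Qed.

Lemma lie_coboundary_cancel l k : lie_cocycle U k ->
  lie_coboundary (lamD l (lamD k (lamN k))) -> lie_coboundary l.
Proof. by move=> _; rewrite lamDN lamC lam0D. Qed.

Definition lieH1_data : subquotient := Subquotient lamA lamC lam0D lamN0 lamNK
  lamND lie_cocycle0 lie_cocycleN lie_cocycleD lie_coboundaryN lie_coboundaryD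
  lie_coboundary_sub lie_coboundary_cancel.

(* The cocycles modulo the X(mu)/mu, rather than modulo the X(f). *)
Definition lieH1 : zmodType := sq_quot lieH1_data.

End LieCocycles.

Section LieRestriction.
Variables (U V : set M) (VU : V `<=` U).

Lemma lie_cocycleS l : lie_cocycle U l -> lie_cocycle V l.
Proof.
move=> [lH lL lC]; split=> [X gX i x /VU|c X Y x gX gY /VU|X Y x gX gY /VU].
- exact: lH.
- exact: lL.
- exact: lC.
Qed.

Lemma lie_dlogS mu l : lie_dlog U mu l -> lie_dlog V mu l.
Proof. by move=> H X x gX /VU; exact: H. Qed.

Lemma lie_coboundaryS l : lie_coboundary U l -> lie_coboundary V l.
Proof.
by move=> [mu Hmu Hl]; exists mu; [exact: nvholS Hmu|exact: lie_dlogS].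
Qed.

Definition lieH1_res_data : sq_morphism (lieH1_data U) (lieH1_data V) :=
  @SqMorphism (lieH1_data U) (lieH1_data V) id (fun _ _ => erefl)
    (fun _ => erefl) lie_cocycleS lie_coboundaryS.

Definition lieH1_res : {additive lieH1 U -> lieH1 V} := sq_map lieH1_res_data.

End LieRestriction.

Lemma lieH1_resE (U V : set M) (p : V `<=` U) l (Hl : lie_cocycle U l) :
  lieH1_res p (sq_cls (A := lieH1_data U) Hl) =
  sq_cls (A := lieH1_data V) (lie_cocycleS p Hl).
Proof. exact: (sq_mapE (lieH1_res_data p)). Qed.

Lemma lieH1_res_id (U : set M) (p : U `<=` U) a : lieH1_res p a = a.
Proof.
by elim/sq_clsW: a => l Hl; rewrite lieH1_resE; exact: sq_cls_irr.
Qed.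

Lemma lieH1_res_comp (U V W : set M) (p : V `<=` U) (q : W `<=` V)
    (r : W `<=` U) a : lieH1_res q (lieH1_res p a) = lieH1_res r a.
Proof.
elim/sq_clsW: a => l Hl.
by rewrite (lieH1_resE p) (lieH1_resE q) (lieH1_resE r); exact: sq_cls_irr.
Qed.

Record open_cover := OpenCover {
  ix : Type;
  mem :> ix -> set M;
  mem_open : forall a, open (mem a);
  mem_cover : forall x, exists a, mem a x }.

Definition refinement_map (U V : open_cover) (r : ix V -> ix U) : Prop :=
  forall a, V a `<=` U (r a).

Definition refined_by (U V : open_cover) : Prop := exists r, @refinement_map U V r.

Definition trivial_cover : open_cover :=
  @OpenCover unit (fun=> setT) (fun=> openT) (fun x => ex_intro _ tt I).

Lemma meet_cover_open (U V : open_cover) (a : ix U * ix V) :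
  open (U a.1 `&` V a.2).
Proof. by apply: openI; exact: mem_open. Qed.

Lemma meet_cover_cover (U V : open_cover) x :
  exists a : ix U * ix V, (U a.1 `&` V a.2) x.
Proof.
by have [a Ua] := mem_cover U x; have [b Vb] := mem_cover V x; exists (a, b).
Qed.

Definition meet_cover (U V : open_cover) : open_cover :=
  OpenCover (@meet_cover_open U V) (@meet_cover_cover U V).

Lemma refined_refl U : refined_by U U.
Proof. by exists id => a. Qed.

Lemma refined_trans V U W : refined_by U V -> refined_by V W -> refined_by U W.
Proof.
move=> [r rP] [s sP]; exists (r \o s) => a x /sP /rP //.
Qed.

Lemma refined_meetl U V : refined_by U (meet_cover U V).
Proof. by exists fst => a x []. Qed.

Lemma refined_meetr U V : refined_by V (meet_cover U V).
Proof. by exists snd => a x []. Qed.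

Definition covers : directed := Directed trivial_cover refined_refl
  refined_trans refined_meetl refined_meetr.

Definition some_refinement (U V : open_cover) (p : refined_by U V) : ix V -> ix U :=
  projT1 (cid p).

Lemma some_refinementP U V (p : refined_by U V) :
  refinement_map (some_refinement p).
Proof. exact: projT2 (cid p). Qed.

Section Cech.
Variable U : open_cover.

Definition cech := ix U -> ix U -> M -> C.
Definition cech1 : cech := fun _ _ _ => 1.
Definition cechV (h : cech) : cech := fun a b x => (h a b x)^-1.
Definition cechM (h k : cech) : cech := fun a b x => h a b x * k a b x.

Lemma cech_ext (h k : cech) : (forall a b x, h a b x = k a b x) -> h = k.
Proof.
move=> hk; apply/funext => a; apply/funext => b; apply/funext => x; exact: hk.
Qed.

Lemma cechA : associative cechM.
Proof. by move=> *; apply: cech_ext => *; exact: mulrA. Qed.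
Lemma cechC : commutative cechM.
Proof. by move=> *; apply: cech_ext => *; exact: mulrC. Qed.
Lemma cech1M : left_id cech1 cechM.
Proof. by move=> *; apply: cech_ext => *; exact: mul1r. Qed.
Lemma cechV1 : cechV cech1 = cech1.
Proof. by apply: cech_ext => *; exact: invr1. Qed.
Lemma cechVK : involutive cechV.
Proof. by move=> *; apply: cech_ext => *; exact: invrK. Qed.
Lemma cechVM : {morph cechV : h k / cechM h k}.
Proof. by move=> *; apply: cech_ext => *; exact: invfM. Qed.

Definition cech_cocycle (h : cech) : Prop :=
  (forall a b, nonvanishing_holomorphic (U a `&` U b) (h a b)) /\
  (forall a b c x, U a x -> U b x -> U c x -> h a b x * h b c x = h a c x).

Definition cech_diff (mu : ix U -> M -> C) (h : cech) : Prop :=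
  forall a b x, U a x -> U b x -> h a b x = mu a x / mu b x.

Lemma cech_cocycle1 : cech_cocycle cech1.
Proof. by split=> [a b|a b c x _ _ _]; [exact: nvhol1|rewrite mulr1]. Qed.

Lemma cech_cocycleV h : cech_cocycle h -> cech_cocycle (cechV h).
Proof.
move=> [hH hC]; split=> [a b|a b c x Ua Ub Uc]; first exact: nvholV.
by rewrite /cechV -invfM hC.
Qed.

Lemma cech_cocycleM h k : cech_cocycle h -> cech_cocycle k ->
  cech_cocycle (cechM h k).
Proof.
move=> [hH hC] [kH kC]; split=> [a b|a b c x Ua Ub Uc]; first exact: nvholM.
by rewrite /cechM mulrACA hC ?kC.
Qed.

Lemma cech_diff1 : cech_diff (fun _ _ => 1) cech1.
Proof. by move=> a b x _ _; rewrite divr1. Qed.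

Lemma cech_diffV mu h : cech_diff mu h -> cech_diff (fun a x => (mu a x)^-1) (cechV h).
Proof. by move=> H a b x Ua Ub; rewrite /cechV H// invfM. Qed.

Lemma cech_diffM mu nu h k : cech_diff mu h -> cech_diff nu k ->
  cech_diff (fun a x => mu a x * nu a x) (cechM h k).
Proof.
by move=> Hh Hk a b x Ua Ub; rewrite /cechM Hh// Hk// invfM mulrACA.
Qed.

Lemma cechMV h a b x : cech_cocycle h -> U a x -> U b x ->
  cechM h (cechV h) a b x = 1.
Proof. by move=> [hH _] Ua Ub; rewrite /cechM /cechV mulfV//; apply: (hH a b).2. Qed.

Definition cech_coboundary (h : cech) : Prop :=
  exists2 mu, (forall a, nonvanishing_holomorphic (U a) (mu a)) & cech_diff mu h.

Lemma cech_coboundaryV h : cech_coboundary h -> cech_coboundary (cechV h).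
Proof.
move=> [mu Hmu Hh]; exists (fun a x => (mu a x)^-1); last exact: cech_diffV.
by move=> a; exact: nvholV.
Qed.

Lemma cech_coboundaryM h k : cech_coboundary h -> cech_coboundary k ->
  cech_coboundary (cechM h k).
Proof.
move=> [mu Hmu Hh] [nu Hnu Hk]; exists (fun a x => mu a x * nu a x).
  by move=> a; exact: nvholM.
exact: cech_diffM.
Qed.

Lemma cech_coboundary_sub h : cech_cocycle h -> cech_coboundary (cechM h (cechV h)).
Proof.
move=> Hh; exists (fun _ _ => 1); first by move=> a; exact: nvhol1.
by move=> a b x Ua Ub; rewrite divr1 cechMV.
Qed.

Lemma cech_coboundary_cancel h k : cech_cocycle k ->
  cech_coboundary (cechM h (cechM k (cechV k))) -> cech_coboundary h.
Proof.
move=> Hk [mu Hmu Hh]; exists mu => // a b x Ua Ub.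
by rewrite -Hh// {1}/cechM cechMV// mulr1.
Qed.

Definition cechH1_data : subquotient := Subquotient cechA cechC cech1M cechV1
  cechVK cechVM cech_cocycle1 cech_cocycleV cech_cocycleM cech_coboundaryV
  cech_coboundaryM cech_coboundary_sub cech_coboundary_cancel.

(* A zmodType, hence written additively: its operation is the pointwise        *)
(* product of cocycles and its zero is the class of the cocycle 1.            *)
Definition cechH1 : zmodType := sq_quot cechH1_data.

(* The pairs (g, lambda), multiplicative in g and additive in lambda. *)
Definition eqv := (cech * (ix U -> lam))%type.
Definition eqv0 : eqv := (cech1, fun=> lam0).
Definition eqvN (c : eqv) : eqv := (cechV c.1, fun a => lamN (c.2 a)).
Definition eqvD (c d : eqv) : eqv := (cechM c.1 d.1, fun a => lamD (c.2 a) (d.2 a)).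

Lemma eqvA : associative eqvD.
Proof.
by move=> c d e; congr pair; [exact: cechA|apply/funext => a; exact: lamA].
Qed.
Lemma eqvC : commutative eqvD.
Proof.
by move=> c d; congr pair; [exact: cechC|apply/funext => a; exact: lamC].
Qed.
Lemma eqv0D : left_id eqv0 eqvD.
Proof.
by move=> [h l]; congr pair; [exact: cech1M|apply/funext => a; exact: lam0D].
Qed.
Lemma eqvN0 : eqvN eqv0 = eqv0.
Proof. by congr pair; [exact: cechV1|apply/funext => a; exact: lamN0]. Qed.
Lemma eqvNK : involutive eqvN.
Proof.
by move=> [h l]; congr pair; [exact: cechVK|apply/funext => a; exact: lamNK].
Qed.
Lemma eqvND : {morph eqvN : c d / eqvD c d}.
Proof.
by move=> c d; congr pair; [exact: cechVM|apply/funext => a; exact: lamND].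
Qed.

Definition eqv_compat (c : eqv) : Prop :=
  forall a b X x, g X -> U a x -> U b x ->
    c.2 a X x - c.2 b X x = vf_app X (c.1 a b) x / c.1 a b x.

Definition eqv_cocycle (c : eqv) : Prop :=
  [/\ cech_cocycle c.1, forall a, lie_cocycle (U a) (c.2 a) & eqv_compat c].

Definition eqv_coboundary (c : eqv) : Prop :=
  exists mu, [/\ forall a, nonvanishing_holomorphic (U a) (mu a),
    cech_diff mu c.1 & forall a, lie_dlog (U a) (mu a) (c.2 a)].

Lemma eqv_cocycle0 : eqv_cocycle eqv0.
Proof.
split=> [|a|a b X x gX Ua Ub]; first exact: cech_cocycle1.
  exact: lie_cocycle0.
by rewrite vf_app_cst mul0r subr0.
Qed.

Lemma eqv_cocycleN c : eqv_cocycle c -> eqv_cocycle (eqvN c).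
Proof.
move=> [cg cl cc]; split=> [|a|a b X x gX Ua Ub]; first exact: cech_cocycleV.
  exact: lie_cocycleN.
have Uab : (U a `&` U b) x by [].
by rewrite (vf_dlogV _ Uab (cg.1 a b)) -cc// /eqvN /lamN /= opprB opprK addrC.
Qed.

Lemma eqv_cocycleD c d : eqv_cocycle c -> eqv_cocycle d ->
  eqv_cocycle (eqvD c d).
Proof.
move=> [cg cl cc] [dg dl dc]; split=> [|a|a b X x gX Ua Ub].
- exact: cech_cocycleM.
- exact: lie_cocycleD.
- have Uab : (U a `&` U b) x by [].
  have H := vf_dlogM X Uab (cg.1 a b) (dg.1 a b).
  have E := congr2 +%R (cc a b X x gX Ua Ub) (dc a b X x gX Ua Ub).
  apply: etrans (etrans E (esym H)).
  by rewrite /eqvD /lamD /= opprD addrACA.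
Qed.

Lemma eqv_coboundaryN c : eqv_coboundary c -> eqv_coboundary (eqvN c).
Proof.
move=> [mu [Hmu Hg Hl]]; exists (fun a x => (mu a x)^-1); split=> [a||a].
- exact: nvholV.
- exact: cech_diffV.
- exact: lie_dlogN.
Qed.

Lemma eqv_coboundaryD c d : eqv_coboundary c -> eqv_coboundary d ->
  eqv_coboundary (eqvD c d).
Proof.
move=> [mu [Hmu Hg Hl]] [nu [Hnu Kg Kl]].
exists (fun a x => mu a x * nu a x); split=> [a||a].
- exact: nvholM.
- exact: cech_diffM.
- exact: lie_dlogD.
Qed.

Lemma eqv_coboundary_sub c : eqv_cocycle c -> eqv_coboundary (eqvD c (eqvN c)).
Proof.
move=> [cg cl cc]; exists (fun _ _ => 1); split=> [a|a b x Ua Ub|a].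
- exact: nvhol1.
- by rewrite divr1; exact: cechMV.
- by have := @lie_dlog1 (U a); rewrite -(lamDN (c.2 a)).
Qed.

Lemma eqv_coboundary_cancel c d : eqv_cocycle d ->
  eqv_coboundary (eqvD c (eqvD d (eqvN d))) -> eqv_coboundary c.
Proof.
move=> [dg _ _] [mu [Hmu Hg Hl]]; exists mu; split=> // [a b x Ua Ub|a X x gX Ua].
  have := Hg a b x Ua Ub.
  by rewrite /= {1}/cechM cechMV// mulr1.
by have := Hl a X x gX Ua; rewrite /= lamDN lamC lam0D.
Qed.

Definition eqvH1_data : subquotient := Subquotient eqvA eqvC eqv0D eqvN0 eqvNK
  eqvND eqv_cocycle0 eqv_cocycleN eqv_cocycleD eqv_coboundaryN eqv_coboundaryD
  eqv_coboundary_sub eqv_coboundary_cancel.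

(* Z^1(U) / B^1(U) *)
Definition eqvH1 : zmodType := sq_quot eqvH1_data.

End Cech.

Section Refinement.
Variables (U V : open_cover) (r : ix V -> ix U) (rP : refinement_map r).

Definition cech_pull (h : cech U) : cech V := fun a b => h (r a) (r b).

Lemma cech_pull_cocycle h : cech_cocycle h -> cech_cocycle (cech_pull h).
Proof.
move=> [hH hC]; split=> [a b|a b c x Va Vb Vc]; last by apply: hC; exact: rP.
by apply: nvholS (hH _ _) => x [Va Vb]; split; exact: rP.
Qed.

Lemma cech_pull_diff mu h : cech_diff mu h -> cech_diff (mu \o r) (cech_pull h).
Proof. by move=> H a b x Va Vb; apply: H; exact: rP. Qed.

Lemma cech_pull_coboundary h : cech_coboundary h -> cech_coboundary (cech_pull h).
Proof.
move=> [mu Hmu Hh]; exists (mu \o r); last exact: cech_pull_diff.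
by move=> a; exact: nvholS (@rP a) (Hmu _).
Qed.

Definition cechH1_pull_data : sq_morphism (cechH1_data U) (cechH1_data V) :=
  @SqMorphism (cechH1_data U) (cechH1_data V) cech_pull (fun _ _ => erefl)
    (fun _ => erefl) cech_pull_cocycle cech_pull_coboundary.

Definition eqv_pull (c : eqv U) : eqv V := (cech_pull c.1, c.2 \o r).

Lemma eqv_pull_cocycle c : eqv_cocycle c -> eqv_cocycle (eqv_pull c).
Proof.
move=> [cg cl cc]; split=> [|a|a b X x gX Va Vb]; first exact: cech_pull_cocycle.
  exact: (lie_cocycleS (@rP a) (cl (r a))).
by apply: cc => //; exact: rP.
Qed.

Lemma eqv_pull_coboundary c : eqv_coboundary c -> eqv_coboundary (eqv_pull c).
Proof.
move=> [mu [Hmu Hg Hl]]; exists (mu \o r); split=> [a||a].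
- exact: nvholS (@rP a) (Hmu _).
- exact: cech_pull_diff.
- exact: (lie_dlogS (@rP a) (Hl (r a))).
Qed.

Definition eqvH1_pull_data : sq_morphism (eqvH1_data U) (eqvH1_data V) :=
  @SqMorphism (eqvH1_data U) (eqvH1_data V) eqv_pull (fun _ _ => erefl)
    (fun _ => erefl) eqv_pull_cocycle eqv_pull_coboundary.

End Refinement.

(* On cohomology, the choice of the refinement map does not matter. *)

Section Independence.
Variables (U V : open_cover) (r s : ix V -> ix U).
Hypotheses (rP : refinement_map r) (sP : refinement_map s).

Let mu (h : cech U) : ix V -> M -> C := fun a => h (r a) (s a).

Lemma pull_mu_hol h a : cech_cocycle h -> nonvanishing_holomorphic (V a) (mu h a).
Proof.
by move=> [hH _]; apply: nvholS (hH _ _) => x Va; split; [exact: rP|exact: sP].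
Qed.

Lemma pull_mu_diff h : cech_cocycle h ->
  cech_diff (mu h) (cechM (cech_pull r h) (cechV (cech_pull s h))).
Proof.
move=> [hH hC] a b x Va Vb; rewrite /cechM /cechV /cech_pull /mu.
have [Ura Urb] := (rP Va, rP Vb); have [Usa Usb] := (sP Va, sP Vb).
have sn0 : h (s a) (s b) x != 0 by apply: (hH _ _).2.
have rsn0 : h (r b) (s b) x != 0 by apply: (hH _ _).2.
apply/eqP; rewrite eqr_div//; apply/eqP.
by rewrite !hC.
Qed.

Lemma cech_pull_indep h : cech_cocycle h ->
  cech_coboundary (cechM (cech_pull r h) (cechV (cech_pull s h))).
Proof.
move=> Hh; exists (mu h); last exact: pull_mu_diff.
by move=> a; exact: pull_mu_hol.
Qed.

Lemma eqv_pull_indep c : eqv_cocycle c ->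
  eqv_coboundary (eqvD (eqv_pull r c) (eqvN (eqv_pull s c))).
Proof.
move=> [cg cl cc]; exists (mu c.1); split=> [a||a X x gX Va].
- exact: pull_mu_hol.
- exact: pull_mu_diff.
- by rewrite -cc//; [exact: rP|exact: sP].
Qed.

End Independence.

Definition cechH1_map U V (p : refined_by U V) : {additive cechH1 U -> cechH1 V} :=
  sq_map (cechH1_pull_data (some_refinementP p)).

Lemma cechH1_mapE U V (p : refined_by U V) r (rP : @refinement_map U V r) h
    (Zh : cech_cocycle h) :
  cechH1_map p (sq_cls (A := cechH1_data U) Zh) =
  sq_cls (A := cechH1_data V) (cech_pull_cocycle rP Zh).
Proof.
rewrite /cechH1_map sq_mapE; apply/sq_clsP.
exact: (cech_pull_indep (some_refinementP p) rP Zh).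
Qed.

Definition eqvH1_map U V (p : refined_by U V) : {additive eqvH1 U -> eqvH1 V} :=
  sq_map (eqvH1_pull_data (some_refinementP p)).

Lemma eqvH1_mapE U V (p : refined_by U V) r (rP : @refinement_map U V r) c
    (Zc : eqv_cocycle c) :
  eqvH1_map p (sq_cls (A := eqvH1_data U) Zc) =
  sq_cls (A := eqvH1_data V) (eqv_pull_cocycle rP Zc).
Proof.
rewrite /eqvH1_map sq_mapE; apply/sq_clsP.
exact: (eqv_pull_indep (some_refinementP p) rP Zc).
Qed.

Lemma refinement_id U : @refinement_map U U id.
Proof. by move=> a. Qed.

Lemma refinement_comp U V W r s : @refinement_map U V r ->
  @refinement_map V W s -> @refinement_map U W (r \o s).
Proof. by move=> rP sP a x /sP /rP. Qed.

Lemma cechH1_map_id U (p : refined_by U U) a : cechH1_map p a = a.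
Proof.
elim/sq_clsW: a => h Zh.
by rewrite (cechH1_mapE p (@refinement_id U) Zh); exact: sq_cls_irr.
Qed.

Lemma cechH1_map_comp U V W (p : refined_by U V) (q : refined_by V W)
    (r : refined_by U W) a :
  cechH1_map q (cechH1_map p a) = cechH1_map r a.
Proof.
elim/sq_clsW: a => h Zh.
have pP := some_refinementP p; have qP := some_refinementP q.
rewrite (cechH1_mapE p pP) (cechH1_mapE q qP).
by rewrite (cechH1_mapE r (refinement_comp pP qP)); exact: sq_cls_irr.
Qed.

Lemma eqvH1_map_id U (p : refined_by U U) a : eqvH1_map p a = a.
Proof.
elim/sq_clsW: a => -[h l] Zh.
by rewrite (eqvH1_mapE p (@refinement_id U) Zh); exact: sq_cls_irr.
Qed.

Lemma eqvH1_map_comp U V W (p : refined_by U V) (q : refined_by V W)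
    (r : refined_by U W) a :
  eqvH1_map q (eqvH1_map p a) = eqvH1_map r a.
Proof.
elim/sq_clsW: a => h Zh.
have pP := some_refinementP p; have qP := some_refinementP q.
rewrite (eqvH1_mapE p pP) (eqvH1_mapE q qP).
by rewrite (eqvH1_mapE r (refinement_comp pP qP)); exact: sq_cls_irr.
Qed.

Definition cechH1_system : directed_system covers :=
  @DirectedSystem covers cechH1 cechH1_map cechH1_map_id cechH1_map_comp.

Definition eqvH1_system : directed_system covers :=
  @DirectedSystem covers eqvH1 eqvH1_map eqvH1_map_id eqvH1_map_comp.

Definition Pic : zmodType := dirlim cechH1_system.

Definition Picg : zmodType := dirlim eqvH1_system.

Section MultCover.
Variable U : open_cover.

Definition mult_compat (h : forall a, lieH1 (U a)) : Prop :=
  forall a b, lieH1_res (@subIsetl _ (U a) (U b)) (h a) =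
              lieH1_res (@subIsetr _ (U a) (U b)) (h b).

Definition multU : Type := {h : forall a, lieH1 (U a) | mult_compat h}.

HB.instance Definition _ := gen_eqMixin multU.
HB.instance Definition _ := gen_choiceMixin multU.

Lemma multU_ext (h k : multU) : (forall a, sval h a = sval k a) -> h = k.
Proof.
by case: h k => [h Hh] [k Hk] /= hk; apply: eq_exist; exact: functional_extensionality_dep.
Qed.

Lemma multU0_subproof : mult_compat (fun a => 0).
Proof. by move=> a b; rewrite !raddf0. Qed.
Lemma multUN_subproof (h : multU) : mult_compat (fun a => - sval h a).
Proof. by move=> a b; rewrite !raddfN (svalP h). Qed.
Lemma multUD_subproof (h k : multU) :
  mult_compat (fun a => sval h a + sval k a).
Proof. by move=> a b; rewrite !raddfD (svalP h) (svalP k). Qed.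

Definition multU0 : multU := exist _ _ multU0_subproof.
Definition multUN (h : multU) : multU := exist _ _ (multUN_subproof h).
Definition multUD (h k : multU) : multU := exist _ _ (multUD_subproof h k).

Lemma multUA : associative multUD.
Proof. by move=> h k l; apply: multU_ext => a; exact: addrA. Qed.
Lemma multUC : commutative multUD.
Proof. by move=> h k; apply: multU_ext => a; exact: addrC. Qed.
Lemma multU0D : left_id multU0 multUD.
Proof. by move=> h; apply: multU_ext => a; exact: add0r. Qed.
Lemma multUND : left_inverse multU0 multUN multUD.
Proof. by move=> h; apply: multU_ext => a; exact: addNr. Qed.

HB.instance Definition _ :=
  GRing.isZmodule.Build multU multUA multUC multU0D multUND.

End MultCover.

Section MultRefinement.
Variables (U V : open_cover) (p : refined_by U V).

Lemma mult_pull_subproof r (rP : @refinement_map U V r) (h : multU U) :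
  mult_compat (fun a => lieH1_res (@rP a) (sval h (r a))).
Proof.
move=> a b.
have E : V a `&` V b `<=` U (r a) `&` U (r b).
  by move=> x [Va Vb]; split; exact: rP.
have El : V a `&` V b `<=` U (r a) by move=> x /E [].
have Er : V a `&` V b `<=` U (r b) by move=> x /E [].
rewrite (lieH1_res_comp _ _ El) (lieH1_res_comp _ _ Er).
by rewrite -(lieH1_res_comp (@subIsetl _ _ _) E El) (svalP h)
  (lieH1_res_comp (@subIsetr _ _ _) E Er).
Qed.

Definition mult_pull r (rP : @refinement_map U V r) (h : multU U) : multU V :=
  exist _ _ (mult_pull_subproof rP h).

Lemma mult_pull_indep r s (rP : @refinement_map U V r)
    (sP : @refinement_map U V s) h : mult_pull rP h = mult_pull sP h.
Proof.
apply: multU_ext => a /=.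
have E : V a `<=` U (r a) `&` U (s a).
  by move=> x Va; split; [exact: rP|exact: sP].
by rewrite -(lieH1_res_comp (@subIsetl _ _ _) E (@rP a)) (svalP h)
  (lieH1_res_comp (@subIsetr _ _ _) E (@sP a)).
Qed.

Definition multU_mapf : multU U -> multU V := mult_pull (some_refinementP p).

Lemma multU_map_additive : zmod_morphism multU_mapf.
Proof. by move=> h k; apply: multU_ext => a; exact: raddfB. Qed.

HB.instance Definition _ :=
  GRing.isZmodMorphism.Build (multU U) (multU V) multU_mapf multU_map_additive.

Definition multU_map : {additive multU U -> multU V} := multU_mapf.

End MultRefinement.

Lemma multU_map_id U (p : refined_by U U) h : multU_map p h = h.
Proof.
rewrite /multU_map /= /multU_mapf (mult_pull_indep _ (@refinement_id U)).
by apply: multU_ext => a /=; rewrite lieH1_res_id.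
Qed.

Lemma multU_map_comp U V W (p : refined_by U V) (q : refined_by V W)
    (r : refined_by U W) h : multU_map q (multU_map p h) = multU_map r h.
Proof.
have pP := some_refinementP p; have qP := some_refinementP q.
rewrite /multU_map /= /multU_mapf (mult_pull_indep _ pP) (mult_pull_indep _ qP).
rewrite (mult_pull_indep _ (refinement_comp pP qP)).
apply: multU_ext => a /=; exact: lieH1_res_comp.
Qed.

Definition mult_system : directed_system covers :=
  @DirectedSystem covers multU multU_map multU_map_id multU_map_comp.

Definition Mult : zmodType := dirlim mult_system.

Section PhiCover.
Variable U : open_cover.

Lemma eqv_fst_cocycle (c : eqv U) : eqv_cocycle c -> cech_cocycle c.1.
Proof. by case. Qed.

Lemma eqv_fst_coboundary (c : eqv U) : eqv_coboundary c -> cech_coboundary c.1.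
Proof. by move=> [mu [Hmu Hg _]]; exists mu. Qed.

Definition Phi1U_data : sq_morphism (eqvH1_data U) (cechH1_data U) :=
  @SqMorphism (eqvH1_data U) (cechH1_data U) fst (fun _ _ => erefl)
    (fun _ => erefl) eqv_fst_cocycle eqv_fst_coboundary.

Definition Phi1U : {additive eqvH1 U -> cechH1 U} := sq_map Phi1U_data.

Lemma eqv_snd_cocycle (c : eqv U) a : eqv_cocycle c -> lie_cocycle (U a) (c.2 a).
Proof. by case. Qed.

Definition eqv_lam_cls (c : eqv U) (Zc : eqv_cocycle c) (a : ix U) : lieH1 (U a) :=
  sq_cls (A := lieH1_data (U a)) (eqv_snd_cocycle a Zc).

Lemma eqv_lam_compat c (Zc : eqv_cocycle c) : mult_compat (eqv_lam_cls Zc).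
Proof.
move=> a b; rewrite /eqv_lam_cls /lieH1_res !sq_mapE; apply/sq_clsP.
case: (Zc) => cg cl cc; exists (c.1 a b); first exact: cg.1.
by move=> X x gX [Ua Ub]; rewrite -cc.
Qed.

Definition Phi2U_pre (c : sg_car (sq_setoid (eqvH1_data U))) : multU U :=
  exist _ _ (eqv_lam_compat (proj2_sig c)).

Lemma Phi2U_preE c d : @sg_eq (sq_setoid (eqvH1_data U)) c d ->
  Phi2U_pre c = Phi2U_pre d.
Proof.
move=> [mu [Hmu _ Hl]]; apply: multU_ext => a; apply/sq_clsP.
by exists (mu a); [exact: Hmu|exact: Hl].
Qed.

Lemma Phi2U_preD c d :
  Phi2U_pre (@sg_add (sq_setoid (eqvH1_data U)) c d) =
  Phi2U_pre c + Phi2U_pre d.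
Proof.
apply: multU_ext => a; rewrite /= /eqv_lam_cls -sq_clsD; exact: sq_cls_irr.
Qed.

Definition Phi2U : {additive eqvH1 U -> multU U} := sg_lift Phi2U_preE Phi2U_preD.

Lemma Phi1UE c (Zc : eqv_cocycle c) :
  Phi1U (sq_cls (A := eqvH1_data U) Zc) =
  sq_cls (A := cechH1_data U) (eqv_fst_cocycle Zc).
Proof. exact: sq_mapE. Qed.

Lemma Phi2UE c (Zc : eqv_cocycle c) a :
  sval (Phi2U (sq_cls (A := eqvH1_data U) Zc)) a = eqv_lam_cls Zc a.
Proof.
exact: (congr1 (fun h : multU U => sval h a) (sg_liftE Phi2U_preE Phi2U_preD
  (exist _ c Zc))).
Qed.

End PhiCover.

Lemma Phi1U_comm U V (p : refined_by U V) c :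
  cechH1_map p (Phi1U U c) = Phi1U V (eqvH1_map p c).
Proof.
elim/sq_clsW: c => c Zc; have pP := some_refinementP p.
rewrite Phi1UE (cechH1_mapE p pP) (eqvH1_mapE p pP) Phi1UE; exact: sq_cls_irr.
Qed.

Lemma Phi2U_comm U V (p : refined_by U V) c :
  multU_map p (Phi2U U c) = Phi2U V (eqvH1_map p c).
Proof.
elim/sq_clsW: c => c Zc; have pP := some_refinementP p.
rewrite (eqvH1_mapE p pP).
apply: (etrans (mult_pull_indep _ pP _)); apply: multU_ext => a.
apply: (etrans _ (esym (Phi2UE (eqv_pull_cocycle pP Zc) a))).
apply: (etrans (congr1 (lieH1_res (@pP a)) (Phi2UE Zc _))).
by rewrite /eqv_lam_cls lieH1_resE; exact: sq_cls_irr.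
Qed.

Definition Phi1 : {additive Picg -> Pic} :=
  dl_map (@DsMorphism covers eqvH1_system cechH1_system Phi1U Phi1U_comm).

Definition Phi2 : {additive Picg -> Mult} :=
  dl_map (@DsMorphism covers eqvH1_system mult_system Phi2U Phi2U_comm).

Lemma Phi1E (U : open_cover) (c : eqv U) (Zc : eqv_cocycle c) :
  Phi1 (dl_cls (D := eqvH1_system) (sq_cls (A := eqvH1_data U) Zc)) =
  dl_cls (D := cechH1_system)
    (sq_cls (A := cechH1_data U) (eqv_fst_cocycle Zc)).
Proof. by rewrite /Phi1 dl_mapE /= Phi1UE. Qed.

Lemma Phi2E (U : open_cover) (c : eqv U) (Zc : eqv_cocycle c) :
  Phi2 (dl_cls (D := eqvH1_system) (sq_cls (A := eqvH1_data U) Zc)) =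
  dl_cls (D := mult_system) (exist _ _ (eqv_lam_compat Zc) : multU U).
Proof.
rewrite /Phi2 dl_mapE /=; congr dl_cls.
by apply: multU_ext => a; rewrite Phi2UE.
Qed.

Definition Tg : set Picg := [set x | (Phi1 x, Phi2 x) = 0 :> Pic * Mult].

End Manifold.

Arguments Pic {R n} M.
Arguments Phi1 {R n M} g.
Arguments Phi2 {R n M} g.
Arguments Tg {R n M} g.

(* Main.v *)
Require Import Defs.
From HB Require Import structures.
From mathcomp Require Import all_boot all_order all_algebra.
From mathcomp Require Import all_classical all_reals all_analysis.

Import GRing.Theory.
Local Open Scope classical_set_scope.
Local Open Scope ring_scope.

(** A homomorphism is injective as soon as its kernel is trivial. When one of
    the two targets vanishes, the kernel of the remaining component is the
    whole of [Tg g], the common kernel of [Phi1 g] and [Phi2 g]. *)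
Theorem corollary1 (R : realType) (n : nat) (M : complex_manifold R n)
    (g : vf_lie_algebra M) :
  ((forall m : Mult g, m = 0) -> Tg g = [set 0] ->
     injective (Phi1 g : Picg g -> Pic M)) /\
  ((forall L : Pic M, L = 0) -> Tg g = [set 0] ->
     injective (Phi2 g : Picg g -> Mult g)).
Proof.
have ker0 x : Tg g = [set 0] -> Phi1 g x = 0 -> Phi2 g x = 0 -> x = 0.
  move=> T0 x1 x2; have : Tg g x by rewrite /Tg /= x1 x2.
  by rewrite T0.
split=> [Mult0 T0 | Pic0 T0]; apply: raddf_inj => x x0.
- exact: ker0 T0 x0 (Mult0 _).
- exact: ker0 T0 (Pic0 _) x0.
Qed.
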